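(* There is an absolute constant $C_{TS}>0$ such that the following holds. Let $\mathrm{ALG}$ be a BIC bandit algorithm such that by some fixed (deterministic) time $T_0$ it almost surely collects at least $$N_{TS}=C_{TS}\,\varepsilon_{TS}^{-2}\,\log(\delta_{TS}^{-1})$$ samples of each arm, where $\varepsilon_{TS}=\min_{i,j\in[K]}\mathbb E[(\mu_i-\mu_j)_+]$ and $\delta_{TS}=\min_{i\in[K]}\Pr[A^*=i]$. Then the algorithm that runs $\mathrm{ALG}$ for the first $T_0$ rounds and Thompson sampling in all subsequent rounds is BIC.
   Context: Incentivized exploration model: there are $K$ arms and rounds $t=1,2,\dots$. Each arm $i$ has an unknown mean reward $\mu_i\in[0,1]$; $\mu_1,\dots,\mu_K$ are drawn independently with $\mu_i\sim\mathcal P_i$, where the priors $\mathcal P_i$ (distributions on $[0,1]$) are known to everyone. Rewards are Bernoulli: given the means, each arm $i$ has an i.i.d. sequence of $\{0,1\}$-valued samples with mean $\mu_i$ (independent across arms), and the $n$-th time arm $i$ is chosen its $n$-th sample is the observed reward. In each round $t$ a (possibly randomized) algorithm recommends an arm $A_t$ based on the history; the agent of round $t$ chooses an arm $A'_t$, whose reward is observed by the algorithm only. Let $\mathcal E_{t-1}=\{A'_s=A_s \text{ for all } s<t\}$. The algorithm is BIC (Bayesian incentive-compatible) if for every round $t$ and all arms $i,j$ with $\Pr[A_t=i]>0$, $\mathbb E[\mu_i-\mu_j\mid A_t=i,\mathcal E_{t-1}]\geq 0$; agents then follow recommendations. $A^*=\min(\arg\max_j\mu_j)$ is the best arm. $\mathcal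 F_t$ is the $\sigma$-algebra generated by chosen arms and rewards before round $t$. Thompson sampling recommends in round $t$ an arm drawn from the conditional law of $A^*$ given $\mathcal F_t$, i.e. $\Pr[A_t=i\mid\mathcal F_t]=\Pr[A^*=i\mid\mathcal F_t]$. $(x)_+=\max(x,0)$. *)

(* Defs.v *)
From HB Require Import structures.
From mathcomp Require Import all_boot all_order all_algebra.
From mathcomp Require Import all_classical all_reals all_analysis.
Set Implicit Arguments. Unset Strict Implicit. Unset Printing Implicit Defensive.
Import Order.TTheory GRing.Theory Num.Theory.
Import numFieldNormedType.Exports.
Local Open Scope classical_set_scope.
Local Open Scope ring_scope.

(** Bayesian bandit model.  Arms are ['I_K].  The mean vector
    [mu : 'I_K -> Omega -> R] lives on an abstract probability space
    [(Omega, P)]; its coordinates are independent (the law of [mu i] is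
    the prior P_i) and take values in [0,1].

    A history of length t is the sequence of (chosen arm, observed 0/1 reward)
    of rounds 0..t-1.  A (possibly randomized) algorithm is a policy: given the
    history it outputs a probability vector over arms (the conditional law of
    the recommendation given the history; its internal randomness is
    independent of the means and of unrevealed samples).  Agents follow
    recommendations (event E_{t-1} of the paper). *)

Definition policy (R : realType) (K : nat) := seq ('I_K * bool) -> 'I_K -> R.

Definition valid_policy (R : realType) (K : nat) (pi : policy R K) : Prop :=
  forall h, (forall i, 0 <= pi h i) /\ \sum_(i < K) pi h i = 1.

Definition bern (R : realType) (m : R) (b : bool) : R := if b then m else 1 - m.

(** Conditional probability, given the means [m], of observing the rewards of
    the history [h] (each pull of an arm reveals a fresh i.i.d. sample). *)
Definition lik (R : realType) (K : nat) (h : seq ('I_K * bool)) (m : 'I_K -> R) : R :=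
  \prod_(x <- h) bern (m x.1) x.2.

(** Probability that the algorithm makes the choices recorded in [h],
    given the rewards recorded in [h]. *)
Definition wt (R : realType) (K : nat) (pi : policy R K) (h : seq ('I_K * bool)) : R :=
  \prod_(s < size h) pi (take s h) (tnth (in_tuple h) s).1.

Definition Emu (R : realType) (d : measure_display) (T : measurableType d)
  (P : probability T R) (K : nat) (mu : 'I_K -> T -> R)
  (g : ('I_K -> R) -> R) : R :=
  Rintegral P setT (fun w => g (fun i => mu i w)).

Definition is_best (R : realType) (K : nat) (m : 'I_K -> R) (i : 'I_K) : bool :=
  [forall j, m j <= m i] && [forall j : 'I_K, (j < i)%N ==> (m j < m i)].

Definition probA (R : realType) (d : measure_display) (T : measurableType d)
  (P : probability T R) (K : nat) (mu : 'I_K -> T -> R) (pi : policy R K)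
  (t : nat) (i : 'I_K) : R :=
  \sum_(h : t.-tuple ('I_K * bool)) wt pi h * pi h i * Emu P mu (lik h).

(** E[(mu_i - mu_j) 1{A_t = i}]. *)
Definition gainA (R : realType) (d : measure_display) (T : measurableType d)
  (P : probability T R) (K : nat) (mu : 'I_K -> T -> R) (pi : policy R K)
  (t : nat) (i j : 'I_K) : R :=
  \sum_(h : t.-tuple ('I_K * bool)) wt pi h * pi h i *
     Emu P mu (fun m => (m i - m j) * lik h m).

Definition BIC (R : realType) (d : measure_display) (T : measurableType d)
  (P : probability T R) (K : nat) (mu : 'I_K -> T -> R) (pi : policy R K) : Prop :=
  forall (t : nat) (i j : 'I_K), 0 < probA P mu pi t i ->
    0 <= gainA P mu pi t i j / probA P mu pi t i.

(** Thompson sampling: recommends i with probability Pr[A^* = i | F_t], the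
    posterior probability (Bayes' rule) that i is the best arm given the
    observed history. *)
Definition ts_policy (R : realType) (d : measure_display) (T : measurableType d)
  (P : probability T R) (K : nat) (mu : 'I_K -> T -> R) : policy R K :=
  fun h i => Emu P mu (fun m => (is_best m i)%:R * lik h m) / Emu P mu (lik h).

Definition then_ts (R : realType) (d : measure_display) (T : measurableType d)
  (P : probability T R) (K : nat) (mu : 'I_K -> T -> R) (alg : policy R K)
  (T0 : nat) : policy R K :=
  fun h => if (size h < T0)%N then alg h else ts_policy P mu h.

(** eps_TS = min_{i <> j} E[(mu_i - mu_j)_+]  (all these values are <= 1). *)
Definition epsTS (R : realType) (d : measure_display) (T : measurableType d)
  (P : probability T R) (K : nat) (mu : 'I_K -> T -> R) : R :=
  \big[Num.min/1]_(p : 'I_K * 'I_K | p.1 != p.2)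
     Emu P mu (fun m => Num.max (m p.1 - m p.2) 0).

Definition deltaTS (R : realType) (d : measure_display) (T : measurableType d)
  (P : probability T R) (K : nat) (mu : 'I_K -> T -> R) : R :=
  \big[Num.min/1]_(i : 'I_K) Emu P mu (fun m => (is_best m i)%:R).

Definition indep_means (R : realType) (d : measure_display) (T : measurableType d)
  (P : probability T R) (K : nat) (mu : 'I_K -> T -> R) : Prop :=
  forall B : 'I_K -> set R, (forall i, measurable (B i)) ->
    fine (P [set w | forall i, B i (mu i w)]) =
    \prod_(i < K) fine (P [set w | B i (mu i w)]).

(* Main.v *)
Require Import Defs.
From HB Require Import structures.
From mathcomp Require Import all_boot all_order all_algebra.
From mathcomp Require Import all_classical all_reals all_analysis.
From mathcomp Require Import measurable_realfun ring lra.
Set Implicit Arguments. Unset Strict Implicit. Unset Printing Implicit Defensive.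
Import Order.TTheory GRing.Theory Num.Theory.
Local Open Scope classical_set_scope.
Local Open Scope ring_scope.

(** Fix arms [i <> j], let [p = Pr(A^* = i)] and let [D] be the mean of arm [i]
    minus that of arm [j].  In a Thompson round, E[D 1(A_t = i)] is
    E[E(D | F_t) 1(A^* = i)], that is, E[D 1(A^* = i)] up to the errors made by
    replacing [D] with the difference of the empirical means of the first [n]
    rewards of both arms, weighted once by the indicator of A^* = i and once by
    its posterior probability.
    - The main term is at least [p eps]: on A^* = i, [D] is its positive part,
      which is positively associated with the event A^* = i because both
      increase with the mean of [i] and decrease with that of [j].
    - Both weights lie in [0,1] and have expectation [p].  The exponential
      supermartingale of the first [n] rewards shows that such a weight picks up
      an error of order p sqrt(log(1/p) / n), at most [p eps / 2] here. *)

(** * Expectations of bounded measurable functions *)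

Section BoundedMeasurable.
Context (R : realType) (d : measure_display) (T : measurableType d)
  (P : probability T R).
Implicit Types f g : T -> R.

Definition bdmeas f := measurable_fun setT f /\ exists M, forall w, `|f w| <= M.

Lemma bdmeas_integrable f : bdmeas f -> P.-integrable setT (EFin \o f).
Proof.
move=> [mf [M fM]]; apply: (measurable_bounded_integrable measurableT) => //=.
  by rewrite [X in (X < _)%E]probability_setT ltry.
exists M; split; first exact: num_real.
by move=> N MN w _ /=; rewrite (le_trans (fM w)) ?ltW.
Qed.

Lemma bdmeas_cst (c : R) : bdmeas (fun=> c).
Proof. by split; [exact: measurable_cst|exists `|c|]. Qed.

Lemma bdmeasD f g : bdmeas f -> bdmeas g -> bdmeas (fun w => f w + g w).
Proof.
move=> [mf [M fM]] [mg [N gN]]; split; first exact: measurable_funD.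
by exists (M + N) => w; rewrite (le_trans (ler_normD _ _)) ?lerD.
Qed.

Lemma bdmeasN f : bdmeas f -> bdmeas (fun w => - f w).
Proof.
move=> [mf [M fM]]; split; first exact: measurable_funN.
by exists M => w; rewrite normrN.
Qed.

Lemma bdmeasB f g : bdmeas f -> bdmeas g -> bdmeas (fun w => f w - g w).
Proof. by move=> bf bg; apply: bdmeasD => //; exact: bdmeasN. Qed.

Lemma bdmeasM f g : bdmeas f -> bdmeas g -> bdmeas (fun w => f w * g w).
Proof.
move=> [mf [M fM]] [mg [N gN]]; split; first exact: measurable_funM.
by exists (M * N) => w; rewrite normrM ler_pM.
Qed.

Lemma bdmeas_sum (I : Type) (r : seq I) (F : I -> T -> R) :
  (forall i, bdmeas (F i)) -> bdmeas (fun w => \sum_(i <- r) F i w).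
Proof.
move=> bF; elim: r => [|i r IH].
  by under eq_fun do rewrite big_nil; exact: bdmeas_cst.
by under eq_fun do rewrite big_cons; exact: bdmeasD.
Qed.

Lemma bdmeas_prod (I : Type) (r : seq I) (F : I -> T -> R) :
  (forall i, bdmeas (F i)) -> bdmeas (fun w => \prod_(i <- r) F i w).
Proof.
move=> bF; elim: r => [|i r IH].
  by under eq_fun do rewrite big_nil; exact: bdmeas_cst.
by under eq_fun do rewrite big_cons; exact: bdmeasM.
Qed.

Lemma bdmeas_expR f : bdmeas f -> bdmeas (fun w => expR (f w)).
Proof.
move=> [mf [M fM]]; split.
  by apply: measurableT_comp => //; exact: measurable_expR.
exists (expR M) => w; rewrite ger0_norm ?expR_ge0// ler_expR.
exact: le_trans (ler_norm _) (fM w).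
Qed.

Lemma bdmeas_bool (b : T -> bool) :
  measurable_fun setT b -> bdmeas (fun w => (b w)%:R).
Proof.
move=> mb; split; last by exists 1 => w; case: (b w); rewrite ?normr1 ?normr0.
rewrite (_ : (fun w => _) = (fun w => if b w then 1 else 0)); last first.
  by apply/funext => w; case: (b w).
by apply: measurable_fun_ifT => //; exact: measurable_cst.
Qed.

Lemma expectD f g : bdmeas f -> bdmeas g ->
  Rintegral P setT (fun w => f w + g w) =
  Rintegral P setT f + Rintegral P setT g.
Proof. by move=> bf bg; apply: RintegralD => //; exact: bdmeas_integrable. Qed.

Lemma expectZ (c : R) f : bdmeas f ->
  Rintegral P setT (fun w => c * f w) = c * Rintegral P setT f.
Proof. by move=> bf; apply: RintegralZl => //; exact: bdmeas_integrable. Qed.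

Lemma expect_cst (c : R) : Rintegral P setT (fun=> c) = c.
Proof. by rewrite Rintegral_cst// [X in fine X]probability_setT mulr1. Qed.

Lemma expectB f g : bdmeas f -> bdmeas g ->
  Rintegral P setT (fun w => f w - g w) =
  Rintegral P setT f - Rintegral P setT g.
Proof. by move=> bf bg; apply: RintegralB => //; exact: bdmeas_integrable. Qed.

Lemma expect_le f g : bdmeas f -> bdmeas g -> (forall w, f w <= g w) ->
  Rintegral P setT f <= Rintegral P setT g.
Proof. by move=> bf bg fg; apply: le_Rintegral => //; exact: bdmeas_integrable. Qed.

Lemma expect_sum (I : Type) (r : seq I) (F : I -> T -> R) :
  (forall i, bdmeas (F i)) ->
  Rintegral P setT (fun w => \sum_(i <- r) F i w) =
  \sum_(i <- r) Rintegral P setT (F i).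
Proof.
move=> bF; elim: r => [|i r IH].
  by under eq_fun do rewrite big_nil; rewrite big_nil expect_cst.
under eq_fun do rewrite big_cons.
by rewrite big_cons expectD ?IH//; exact: bdmeas_sum.
Qed.

Lemma measurable_event (b : T -> bool) :
  measurable_fun setT b -> measurable [set w | b w].
Proof.
by move=> mb; rewrite -[X in measurable X]setTI; exact: (mb measurableT [set true]).
Qed.

Lemma expect_bool (b : T -> bool) : measurable_fun setT b ->
  Rintegral P setT (fun w => (b w)%:R) = fine (P [set w | b w]).
Proof.
move=> mb; rewrite /Rintegral.
rewrite (_ : (fun w => _) = (fun w => (\1_[set w | b w] w : R)%:E)); last first.
  by apply/funext => w; rewrite indicE mem_setE.
rewrite integral_indic// ?setIT//.
exact: measurable_event.
Qed.

End BoundedMeasurable.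

Lemma measurable_forall (d : measure_display) (T : measurableType d)
    (I : finType) (b : I -> T -> bool) :
  (forall k, measurable_fun setT (b k)) ->
  measurable_fun setT (fun w => [forall k, b k w]).
Proof.
move=> mb; rewrite (_ : (fun w => _) = (fun w => \big[andb/true]_k b k w)).
  2: by apply/funext => w; rewrite big_andE.
elim: (index_enum I) => [|k r IH].
  by under eq_fun do rewrite big_nil; exact: measurable_cst.
by under eq_fun do rewrite big_cons; exact: measurable_and.
Qed.

(** * Independence of one mean from all the others jointly *)

Section IndependentMeans.
Context (R : realType) (d : measure_display) (T : measurableType d)
  (P : probability T R) (K : nat) (mu : 'I_K -> T -> R).
Hypotheses (mmu : forall i, measurable_fun setT (mu i))
  (mu_indep : indep_means P mu).

(** Generating pi-system for the joint sigma-algebra of all means but [mu j], which also contains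
    comparisons between them. *)
Definition rectangles_off (j : 'I_K) : set (set T) :=
  [set A | exists2 B : 'I_K -> set R, (forall k, measurable (B k)) &
    A = [set w | forall k, k != j -> B k (mu k w)]].

Local Notation off j := (g_sigma_algebraType (rectangles_off j)).

Lemma measurable_mean_off (j k : 'I_K) :
  k != j -> measurable_fun setT (mu k : off j -> R).
Proof.
move=> kj _ C mC; rewrite setTI; apply: sub_sigma_algebra.
exists (fun l => if l == k then C else setT) => [l|].
  by case: ifP.
apply/seteqP; split => [w Cw l _ /=|w /(_ k kj)]; last by rewrite eqxx.
by case: eqP => // ->.
Qed.

Lemma measurable_comp_off (c : R -> bool) (j k : 'I_K) :
  k != j -> measurable_fun setT c ->
  measurable_fun setT ((fun w => c (mu k w)) : off j -> bool).
Proof.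
by move=> kj mc; have := measurableT_comp mc (measurable_mean_off kj); exact.
Qed.

Lemma rectangles_off_measurable j : rectangles_off j `<=` measurable.
Proof.
move=> _ [B mB ->].
rewrite (_ : [set _ | _] =
    \bigcap_(k in [set k | k != j]) (setT `&` mu k @^-1` B k)).
  by apply: fin_bigcap_measurable => [|k _]; [exact: finite_finset|exact: mmu].
by apply/seteqP; split => [w Bw k kj|w Bw k kj]; [split => //; exact: Bw|case: (Bw k kj)].
Qed.

Lemma rectangles_off_indep j (C : set R) (A : set T) :
  measurable C -> rectangles_off j A ->
  fine (P ((mu j @^-1` C) `&` A)) = fine (P (mu j @^-1` C)) * fine (P A).
Proof.
move=> mC [B mB ->].
(* A constraint D on [mu j] completes the rectangle to one over all arms; the instance D = [setT]
   evaluates P(A) itself. *)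
have rect D : measurable D ->
    fine (P ((mu j @^-1` D) `&` [set w | forall k, k != j -> B k (mu k w)])) =
    fine (P (mu j @^-1` D)) * \prod_(k < K | k != j) fine (P [set w | B k (mu k w)]).
  move=> mD; pose BD k := if k == j then D else B k.
  rewrite (_ : _ `&` _ = [set w | forall k, BD k (mu k w)]); last first.
    apply/seteqP; split => [w [Dw Bw] k|w Bw].
      by rewrite /BD; case: eqP => [->//|/eqP]; exact: Bw.
    split => [|k kj]; first by have := Bw j; rewrite /BD eqxx.
    by have := Bw k; rewrite /BD (negbTE kj).
  rewrite mu_indep; last by move=> k; rewrite /BD; case: ifP.
  rewrite (bigD1 j)//=; congr (_ * _); first by rewrite /BD eqxx.
  by apply: eq_bigr => k kj; rewrite /BD (negbTE kj).
have := rect _ (@measurableT _ R); rewrite preimage_setT setTI => ->.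
by rewrite rect// [X in _ = _ * (fine X * _)]probability_setT mul1r.
Qed.

Lemma rectangles_off_setI j : setI_closed (rectangles_off j).
Proof.
move=> _ _ [B mB ->] [B' mB' ->]; exists (fun k => B k `&` B' k).
  by move=> k; exact: measurableI.
apply/seteqP; split => [w [Bw B'w] k kj|w Bw].
  by split; [exact: Bw|exact: B'w].
by split => k kj; case: (Bw k kj).
Qed.

(** Both sides are finite measures in A, and they agree on a pi-system containing the whole
    space. *)
Lemma sigma_off_indep j (C : set R) (A : set T) :
  measurable C -> <<s rectangles_off j >> A ->
  fine (P ((mu j @^-1` C) `&` A)) = fine (P (mu j @^-1` C)) * fine (P A).
Proof.
move=> mC sA.
have mjC : measurable (mu j @^-1` C) by rewrite -[X in measurable X]setTI; exact: mmu.
have pC_ge0 : (0 <= fine (P (mu j @^-1` C)))%R by exact: fine_ge0.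
pose m1 : {measure set T -> \bar R} := mrestr P mjC.
pose m2 : {measure set T -> \bar R} := mscale (NngNum pC_ge0) P.
have mA : measurable A.
  apply: smallest_sub sA; first exact: sigma_algebra_measurable.
  exact: rectangles_off_measurable.
have offT : rectangles_off j setT.
  by exists (fun=> setT) => //; apply/seteqP; split.
suff : m1 A = m2 A.
  rewrite /m1 /m2 /= /mrestr /mscale /= setIC => ->.
  by rewrite [LHS]fineM// fin_num_measure.
apply: (@g_sigma_algebra_measure_unique _ _ _ (rectangles_off j) _ (fun=> setT)) => //.
- exact: rectangles_off_measurable.
- by rewrite bigcup_const.
- exact: rectangles_off_setI.
- move=> D offD; rewrite /m1 /m2 /= /mrestr /mscale /= setIC.
  have mD := rectangles_off_measurable offD.
  rewrite -[LHS]fineK ?fin_num_measure//; last exact: measurableI.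
  by rewrite rectangles_off_indep// EFinM [X in (_ * X)%E]fineK// fin_num_measure.
- move=> _; rewrite /m1 /= /mrestr /= setTI.
  by rewrite (le_lt_trans (probability_le1 _ _)) ?ltry.
Qed.

Lemma measurable_off j (b : T -> bool) :
  measurable_fun setT (b : off j -> bool) -> measurable_fun setT b.
Proof.
move=> mb _ Y mY.
have := mb measurableT Y mY.
apply: smallest_sub; first exact: sigma_algebra_measurable.
exact: rectangles_off_measurable.
Qed.

Local Notation "E[ b ]" := (Rintegral P setT (fun w => (b w)%:R)).

Lemma expect_off_indep j (c : R -> bool) (b : T -> bool) :
  measurable_fun setT c -> measurable_fun setT (b : off j -> bool) ->
  E[ fun w => c (mu j w) && b w ] = E[ c \o mu j ] * E[ b ].
Proof.
move=> mc mb; have mb' := measurable_off mb.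
have mcj : measurable_fun setT (c \o mu j) by exact: measurableT_comp.
rewrite !expect_bool//; last exact: measurable_and.
rewrite -(@sigma_off_indep j [set x | c x])//; first last.
- by have := mb measurableT [set true]; rewrite setTI; exact.
- exact: measurable_event.
by congr (fine (P _)); apply/seteqP; split => w /=; [case/andP|move=> [-> ->]].
Qed.
End IndependentMeans.

(** * The best arm and its association with a gap event *)

Definition beats (R : realType) (K : nat) (m : 'I_K -> R) (i k : 'I_K) : bool :=
  if (k < i)%N then m k < m i else m k <= m i.

(** Turns A^* = i into a conjunction over opponents, from which a single opponent can be split off;
    ties favour the smaller index. *)
Lemma is_best_beats (R : realType) (K : nat) (m : 'I_K -> R) (i : 'I_K) :
  is_best m i = [forall k, beats m i k].
Proof.
apply/andP/forallP => [[/forallP le_mi /forallP lt_mi] k|m_beat].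
  by rewrite /beats; case: ifP => [ki|_]; [exact: implyP (lt_mi k) ki|].
split; apply/forallP => k; have := m_beat k; rewrite /beats; case: ifP => //.
by move=> _ /ltW.
Qed.

Section Association.
Context (R : realType) (d : measure_display) (T : measurableType d)
  (P : probability T R) (K : nat) (mu : 'I_K -> T -> R).
Hypotheses (mmu : forall i, measurable_fun setT (mu i))
  (mu_indep : indep_means P mu).

Local Notation "E[ b ]" := (Rintegral P setT (fun w => (b w)%:R)).

Lemma expect_bool_le (b c : T -> bool) :
  measurable_fun setT b -> measurable_fun setT c ->
  (forall w, b w -> c w) -> E[ b ] <= E[ c ].
Proof.
move=> mb mc bc; apply: expect_le; [exact: bdmeas_bool..|move=> w].
by have := bc w; case: (b w); case: (c w) => // /(_ isT).
Qed.

Lemma expect_boolN (b : T -> bool) :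
  measurable_fun setT b -> E[ fun w => ~~ b w ] = 1 - E[ b ].
Proof.
move=> mb; rewrite -[X in _ = X - _](expect_cst P) -expectB; last 2 first.
- exact: bdmeas_cst.
- exact: bdmeas_bool.
by congr Rintegral; apply/funext => w; case: (b w); rewrite ?subrr ?subr0.
Qed.

Lemma expect_bool_split (b c : T -> bool) :
  measurable_fun setT b -> measurable_fun setT c ->
  E[ c ] = E[ fun w => b w && c w ] + E[ fun w => ~~ b w && c w ].
Proof.
move=> mb mc; rewrite -expectD; last 2 first.
- by apply: bdmeas_bool; exact: measurable_and.
- by apply: bdmeas_bool; apply: measurable_and => //; exact: measurable_neg.
by congr Rintegral; apply/funext => w; case: (b w); rewrite ?addr0 ?add0r.
Qed.

Lemma measurable_beats (d' : measure_display) (T' : measurableType d')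
    (nu : 'I_K -> T' -> R) (i k : 'I_K) :
  measurable_fun setT (nu i) -> measurable_fun setT (nu k) ->
  measurable_fun setT (fun w => beats (nu^~ w) i k).
Proof.
move=> mi mk; rewrite /beats; case: (k < i)%N.
  exact: measurable_fun_ltr.
exact: measurable_fun_ler.
Qed.

Lemma measurable_is_best (i : 'I_K) :
  measurable_fun setT (fun w => is_best (mu^~ w) i).
Proof.
rewrite (_ : (fun w => _) = (fun w => [forall k, beats (mu^~ w) i k])).
  2: by apply/funext => w; rewrite is_best_beats.
apply: measurable_forall => k; exact: (measurable_beats (nu := mu)).
Qed.

(* Harris' inequality in two steps: first [mu j] is decoupled from the event
   that [i] beats every arm but [j], then that event is compared on both sides
   of the threshold [s] with the event that all other means are at most [s]. *)
Lemma gap_event_assoc (i j : 'I_K) (s : R) : i != j ->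
  E[ fun w => (mu j w <= s) && (s < mu i w) ] *
    E[ fun w => is_best (mu^~ w) i ] <=
  E[ fun w => ((mu j w <= s) && (s < mu i w)) && is_best (mu^~ w) i ].
Proof.
move=> ij; have ji : j != i by rewrite eq_sym.
pose U w := s < mu i w; pose V w := mu j w <= s.
pose W w := [forall k, (k != j) ==> beats (mu^~ w) i k].
pose Q w := [forall k, (k != i) && (k != j) ==> (mu k w <= s)].
have mlt (x : R) : measurable_fun setT (fun y : R => x < y).
  by apply: measurable_fun_ltr => //; exact: measurable_cst.
have mle (x : R) : measurable_fun setT (fun y : R => y <= x).
  by apply: measurable_fun_ler => //; exact: measurable_cst.
have mU : measurable_fun setT U by exact: measurableT_comp (mlt s) (mmu i).
have mV : measurable_fun setT V by exact: measurableT_comp (mle s) (mmu j).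
have mW : measurable_fun setT W.
  apply: measurable_forall => k; case: (k != j) => /=.
    exact: (measurable_beats (nu := mu)).
  exact: measurable_cst.
have mB := measurable_is_best i.
have mQi : measurable_fun setT (Q : g_sigma_algebraType (rectangles_off mu i) -> bool).
  apply: measurable_forall => k.
  have [/andP[ki _]|_] := boolP ((k != i) && (k != j)); last exact: measurable_cst.
  by have := measurable_comp_off (mu := mu) ki (mle s); exact.
have mQ := measurable_off mmu mQi.
have mUj : measurable_fun setT
    (U : g_sigma_algebraType (rectangles_off mu j) -> bool).
  by have := measurable_comp_off (mu := mu) ij (mlt s); exact.
have mWj : measurable_fun setT
    (W : g_sigma_algebraType (rectangles_off mu j) -> bool).
  apply: measurable_forall => k; have [kj|] := boolP (k != j).
    apply: (measurable_beats
      (nu := fun k => mu k : g_sigma_algebraType (rectangles_off mu j) -> R));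
      exact: measurable_mean_off.
  by move=> _; exact: measurable_cst.
have indV b := @expect_off_indep _ _ _ P _ _ mmu mu_indep j (fun x => x <= s) b (mle s).
rewrite (indV U)//.
(* When the threshold separates the two means, i beats j automatically, so only the other opponents
   matter. *)
have UV_best w : [&& V w, U w & W w] -> (V w && U w) && is_best (mu^~ w) i.
  move=> /and3P[Vw Uw /forallP Ww]; rewrite Vw Uw is_best_beats /=.
  apply/forallP => k; have [->|kj] := eqVneq k j; last exact: implyP (Ww k) kj.
  have jlti : mu j w < mu i w by exact: le_lt_trans Vw Uw.
  by rewrite /beats; case: ifP => // _; exact: ltW.
apply: le_trans (expect_bool_le _ _ UV_best); first last.
- by do ![apply: measurable_and => //].
- by do ![apply: measurable_and => //].
rewrite (indV (fun w => U w && W w)); last exact: measurable_and.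
rewrite -mulrA; apply: ler_wpM2l; first by apply: Rintegral_ge0 => w _; rewrite ler0n.
have best_W : E[ fun w => is_best (mu^~ w) i ] <= E[ W ].
  apply: expect_bool_le => // w; rewrite is_best_beats => /forallP b.
  by apply/forallP => k; apply/implyP.
have U_ge0 : 0 <= E[ U ] by apply: Rintegral_ge0 => w _; rewrite ler0n.
apply: le_trans (ler_wpM2l U_ge0 best_W) _.
have NU_ge0 : 0 <= 1 - E[ U ].
  by rewrite -expect_boolN//; apply: Rintegral_ge0 => w _; rewrite ler0n.
have indQ c mc := @expect_off_indep _ _ _ P _ _ mmu mu_indep i c Q mc mQi.
(* If [mu i] exceeds s and the remaining means do not, then i beats them. *)
have UW_ge : E[ U ] * E[ Q ] <= E[ fun w => U w && W w ].
  rewrite -(indQ (fun x => s < x))//.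
  apply: expect_bool_le; [exact: measurable_and..|] => w /andP[Uw /forallP Qw].
  rewrite /U Uw; apply/forallP => k; apply/implyP => kj.
  have [->|ki] := eqVneq k i; first by rewrite /beats ltnn.
  have Qk : mu k w <= s by apply: (implyP (Qw k)); rewrite ki.
  have klti : mu k w < mu i w by exact: le_lt_trans Qk Uw.
  by rewrite /beats; case: ifP => // _; exact: ltW.
(* Conversely, opponents beaten by an arm whose mean is at most s have means at most s. *)
have NUW_le : E[ fun w => ~~ U w && W w ] <= (1 - E[ U ]) * E[ Q ].
  rewrite -expect_boolN// -(indQ (fun x => ~~ (s < x))); last exact: measurable_neg.
  apply: expect_bool_le; [by apply: measurable_and => //; exact: measurable_neg..|].
  move=> w /andP[Uw /forallP Ww]; rewrite [X in X && _]Uw /=.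
  apply/forallP => k; apply/implyP => /andP[ki kj].
  apply: (@le_trans _ _ (mu i w)); last by rewrite leNgt.
  by have := implyP (Ww k) kj; rewrite /beats; case: ifP => // _ /ltW.
rewrite (expect_bool_split mU mW).
set a := E[ fun w => U w && W w ] in UW_ge *.
set b := E[ fun w => ~~ U w && W w ] in NUW_le *.
set u := E[ U ] in U_ge0 NU_ge0 UW_ge NUW_le *; set q := E[ Q ] in UW_ge NUW_le *.
(* Both bounds pass through u (1 - u) q: they give u b <= (1 - u) a, that is, u (a + b) <= a. *)
have h1 := ler_wpM2l NU_ge0 UW_ge; have h2 := ler_wpM2l U_ge0 NUW_le.
lra.
Qed.

End Association.

(** * From threshold events to the positive part of the gap *)

Lemma count_below (R : realDomainType) (n : nat) (z : R) : 0 <= z <= n%:R ->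
  z <= \sum_(k < n) (k%:R < z :> R)%:R <= z + 1.
Proof.
(* The sum counts the naturals below z, so it is the ceiling of z. *)
elim: n => [|n IH] /andP[z_ge0 z_len].
  by rewrite big_ord0; apply/andP; split; lra.
rewrite big_ord_recr /=; have [n_ltz|z_len'] := ltP n%:R z.
  rewrite (eq_bigr (fun=> 1)) => [|k _]; last first.
    by rewrite (lt_trans _ n_ltz) ?ltr_nat.
  rewrite sumr_const card_ord /= -natr1 in z_len *; apply/andP; split; lra.
by rewrite addr0; apply: IH; rewrite z_ge0.
Qed.

(** Layer-cake formula: (x - y)_+ is the integral over s of 1(y <= s < x), here discretised on the
    grid k / n. *)
Lemma gap_riemann_sum (R : realFieldType) (n : nat) (x y : R) : (0 < n)%N ->
  0 <= x <= 1 -> 0 <= y <= 1 ->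
  `|\sum_(k < n) ((y <= k%:R / n%:R) && (k%:R / n%:R < x :> R))%:R
    - n%:R * Num.max (x - y) 0| <= 1.
Proof.
move=> n_gt0 /andP[x0 x1] /andP[y0 y1].
have n_gt0' : 0 < n%:R :> R by rewrite ltr0n.
have [xy|yx] := leP x y.
  rewrite big1 => [|k _]; last first.
    by case: (leP y) => //= yk; rewrite ltNge (le_trans xy yk).
  by rewrite (_ : Num.max _ _ = 0) ?mulr0 ?subrr ?normr0 ?ler01//; apply: max_r; lra.
rewrite (_ : Num.max _ _ = x - y); last by apply: max_l; lra.
rewrite (eq_bigr (fun k : 'I_n =>
  (k%:R < n%:R * x :> R)%:R - (k%:R < n%:R * y :> R)%:R)); last first.
  move=> k _; rewrite ltr_pdivrMr// ler_pdivlMr// [x * _]mulrC [y * _]mulrC leNgt.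
  have [ky|ky] := ltP _ (n%:R * y); last by rewrite subr0.
  by rewrite (lt_trans ky) ?subrr// ltr_pM2l.
have nx : 0 <= n%:R * x <= n%:R.
  by apply/andP; split; [exact: mulr_ge0|rewrite ger_pMr].
have ny : 0 <= n%:R * y <= n%:R.
  by apply/andP; split; [exact: mulr_ge0|rewrite ger_pMr].
have := count_below nx; have := count_below ny.
rewrite sumrB ler_norml mulrBr => /andP[? ?] /andP[? ?]; apply/andP; split; lra.
Qed.

Section Gap.
Context (R : realType) (d : measure_display) (T : measurableType d)
  (P : probability T R) (K : nat) (mu : 'I_K -> T -> R).
Hypotheses (mmu : forall i, measurable_fun setT (mu i))
  (mu01 : forall i w, 0 <= mu i w <= 1)
  (mu_indep : indep_means P mu).

Local Notation "E[ f ]" := (Rintegral P setT f).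

Lemma bdmeas_mean (i : 'I_K) : bdmeas (mu i).
Proof.
by split => //; exists 1 => w; have /andP[? ?] := mu01 i w; rewrite ger0_norm.
Qed.

Lemma bdmeas_is_best (i : 'I_K) : bdmeas (fun w => (is_best (mu^~ w) i)%:R : R).
Proof. by apply: bdmeas_bool; exact: measurable_is_best. Qed.

Lemma bdmeas_gap_pos (i j : 'I_K) : bdmeas (fun w => Num.max (mu i w - mu j w) 0).
Proof.
have [mD _] := bdmeasB (bdmeas_mean i) (bdmeas_mean j).
split; first by apply: measurable_maxr => //; exact: measurable_cst.
exists 1 => w; have /andP[? ?] := mu01 i w; have /andP[? ?] := mu01 j w.
by rewrite ger0_norm ?le_max ?lexx ?orbT// ge_max ler01 andbT; lra.
Qed.

(** Integrates [gap_event_assoc] over the threshold, as a sum over a grid of n points: a failure by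
    x > 0 would grow to n x, while the rounding errors of the two sums total at most 2. *)
Lemma expect_gap_best (i j : 'I_K) : i != j ->
  E[ fun w => Num.max (mu i w - mu j w) 0 ] * E[ fun w => (is_best (mu^~ w) i)%:R ]
  <= E[ fun w => (mu i w - mu j w) * (is_best (mu^~ w) i)%:R ].
Proof.
move=> ij; set gap := fun w => Num.max _ _; set best := fun w => _%:R.
(* The positive part may replace the gap, since A^* = i forces [mu j <= mu i]. *)
rewrite (_ : (fun w => _ * _) = (fun w => gap w * best w)); last first.
  apply/funext => w; rewrite /gap /best.
  have [|_] := boolP (is_best _ i); last by rewrite !mulr0.
  by case/andP => /forallP/(_ j) ji _; rewrite (elimT max_idPl)// subr_ge0.
have bgap : bdmeas gap by exact: bdmeas_gap_pos.
have bbest : bdmeas best by exact: bdmeas_is_best.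
have best_le1 : E[ best ] <= 1.
  rewrite -[X in _ <= X](expect_cst P); apply: expect_le => //; first exact: bdmeas_cst.
  by move=> w; rewrite /best; case: is_best; rewrite ?ler01.
have best_ge0 : 0 <= E[ best ] by apply: Rintegral_ge0 => w _; rewrite /best ler0n.
rewrite leNgt; apply/negP => lt_gap.
pose x := E[ gap ] * E[ best ] - E[ fun w => gap w * best w ].
have x_gt0 : 0 < x by rewrite subr_gt0.
have [n n_gt] : exists n : nat, 2 / x < n%:R.
  by exists (Num.truncn (2 / x)).+1; exact: truncnS_gt.
have n_gt0 : (0 < n)%N by rewrite -(ltr0n R) (le_lt_trans _ n_gt)// divr_ge0// ltW.
pose I (k : 'I_n) w := (mu j w <= k%:R / n%:R) && (k%:R / n%:R < mu i w).
have mI k : measurable_fun setT (I k).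
  by apply: measurable_and; [apply: measurable_fun_ler|apply: measurable_fun_ltr] => //;
     exact: measurable_cst.
have bI k : bdmeas (fun w => (I k w)%:R : R) by exact: bdmeas_bool.
have bIb k : bdmeas (fun w => (I k w)%:R * best w) by exact: bdmeasM.
have riem w : `|\sum_(k < n) (I k w)%:R - n%:R * gap w| <= 1 by exact: gap_riemann_sum.
have le1 : n%:R * E[ gap ] <= \sum_(k < n) E[ fun w => (I k w)%:R ] + 1.
  rewrite -expectZ// -expect_sum// -[X in _ + X](expect_cst P) -expectD; first last.
  - exact: bdmeas_cst.
  - exact: bdmeas_sum.
  apply: expect_le => [||w]; first by apply: bdmeasM => //; exact: bdmeas_cst.
    by apply: bdmeasD; [exact: bdmeas_sum|exact: bdmeas_cst].
  by have := riem w; rewrite ler_norml => /andP[? ?]; lra.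
have le2 : \sum_(k < n) E[ fun w => (I k w)%:R * best w ] <=
    n%:R * E[ fun w => gap w * best w ] + E[ best ].
  rewrite -expectZ -?expect_sum -?expectD//; last 2 first.
  - by apply: bdmeasM; [exact: bdmeas_cst|exact: bdmeasM].
  - exact: bdmeasM.
  apply: expect_le => [||w]; first exact: bdmeas_sum.
    by apply: bdmeasD => //; apply: bdmeasM; [exact: bdmeas_cst|exact: bdmeasM].
  rewrite -mulr_suml mulrA -[X in _ + X]mul1r -mulrDl.
  apply: ler_wpM2r; first by rewrite /best ler0n.
  by have := riem w; rewrite ler_norml => /andP[? ?]; lra.
have le3 : (\sum_(k < n) E[ fun w => (I k w)%:R ]) * E[ best ] <=
    \sum_(k < n) E[ fun w => (I k w)%:R * best w ].
  rewrite mulr_suml; apply: ler_sum => k _.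
  apply: (le_trans (gap_event_assoc mmu mu_indep (k%:R / n%:R) ij)).
  by rewrite le_eqVlt; apply/orP; left; apply/eqP; congr Rintegral; apply/funext => w;
    rewrite /best -natrM mulnb.
have : n%:R * x <= 2.
  rewrite /x mulrBr; have := ler_wpM2r best_ge0 le1; rewrite mulrDl mul1r -mulrA; lra.
by rewrite -ler_pdivlMr// leNgt n_gt.
Qed.
End Gap.

(** * Histories, likelihoods and exponential tilts *)

Lemma sum_tuple_rcons (V : nmodType) (X : finType) (t : nat) (F : seq X -> V) :
  \sum_(h : t.+1.-tuple X) F h = \sum_(h : t.-tuple X) \sum_x F (rcons h x).
Proof.
rewrite pair_bigA /=.
rewrite (reindex (fun p : t.-tuple X * X => [tuple of rcons p.1 p.2])) /=.
  by apply: eq_bigl.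
apply/onW_bij/inj_card_bij => [[h x] [h' x'] /(congr1 val)/=/rcons_inj[hh' ->]|].
  by congr pair; exact: val_inj.
by rewrite card_prod !card_tuple expnSr.
Qed.

Section Histories.
Context (R : realType) (K : nat).
Implicit Types (h : seq ('I_K * bool)) (m : 'I_K -> R) (pi : policy R K).

Lemma wt_rcons pi h x : wt pi (rcons h x) = wt pi h * pi h x.1.
Proof.
have wtE h' : \prod_(s < size h') pi (take s h') (tnth (in_tuple h') s).1 =
    \prod_(s < size h') pi (take s h') (nth x h' s).1.
  by apply: eq_bigr => s _; rewrite (tnth_nth x).
rewrite /wt !wtE size_rcons big_ord_recr /= nth_rcons ltnn eqxx -cats1 take_size_cat//.
congr (_ * _); apply: eq_bigr => s _.
by rewrite nth_cat ltn_ord takel_cat// ltnW.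
Qed.

Lemma lik_rcons h x m : lik (rcons h x) m = lik h m * bern (m x.1) x.2.
Proof. by rewrite /lik -cats1 big_cat big_seq1. Qed.

Lemma bern_ge0 (p : R) b : 0 <= p <= 1 -> 0 <= bern p b.
Proof. by case/andP; case: b => /= *; lra. Qed.

Lemma bern_le1 (p : R) b : 0 <= p <= 1 -> bern p b <= 1.
Proof. by case/andP; case: b => /= *; lra. Qed.

Lemma lik_ge0 h m : (forall i, 0 <= m i <= 1) -> 0 <= lik h m.
Proof. by move=> m01; apply: prodr_ge0 => x _; exact: bern_ge0. Qed.

Lemma lik_le1 h m : (forall i, 0 <= m i <= 1) -> lik h m <= 1.
Proof.
move=> m01; rewrite /lik; apply: prodr_ile1 => x _.
by rewrite bern_ge0//= bern_le1.
Qed.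

Lemma wt_ge0 pi h : (forall h i, 0 <= pi h i) -> 0 <= wt pi h.
Proof. by move=> pi_ge0; apply: prodr_ge0 => s _. Qed.

(** Inverting exp(-x) >= 1 - x gives exp x <= 1 / (1 - x), and (1 + x + 2 x^2)(1 - x) >= 1 when x <=
    1/2. *)
Lemma expR_le_quadratic (x : R) : `|x| <= 2^-1 -> expR x <= 1 + x + 2 * x ^+ 2.
Proof.
rewrite ler_norml => /andP[x_ge x_le].
have := expR_ge1Dx (- x); rewrite expRN => le_inv.
have x1 : 0 < 1 - x by lra.
apply: (@le_trans _ _ (1 - x)^-1).
  by rewrite -[X in X <= _]invrK lef_pV2 ?posrE ?invr_gt0 ?expR_gt0.
rewrite -[X in X <= _]mul1r ler_pdivrMr//.
rewrite (_ : (_ + _) * _ = 1 + x ^+ 2 * (1 - 2 * x)); last by ring.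
by rewrite lerDl mulr_ge0 ?sqr_ge0//; lra.
Qed.

(* Hoeffding's lemma, with the cruder constant 1 instead of 1/8. *)
Lemma bern_mgf (p a : R) : 0 <= p <= 1 -> `|a| <= 2^-1 ->
  \sum_(b : bool) bern p b * expR (a * (b%:R - p) - a ^+ 2) <= 1.
Proof.
move=> /andP[p0 p1] a_le.
have expb (b : bool) : expR (a * (b%:R - p)) <=
    1 + a * (b%:R - p) + 2 * (a * (b%:R - p)) ^+ 2.
  apply: expR_le_quadratic; rewrite normrM -[X in _ <= X]mulr1 ler_pM//.
  by rewrite ler_norml; apply/andP; case: b; split => /=; lra.
have -> : \sum_(b : bool) bern p b * expR (a * (b%:R - p) - a ^+ 2) =
    (\sum_(b : bool) bern p b * expR (a * (b%:R - p))) * expR (- a ^+ 2).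
  by rewrite mulr_suml; apply: eq_bigr => b _; rewrite expRD mulrA.
rewrite -ler_pdivlMr ?expR_gt0// -expRN opprK mul1r.
apply: le_trans (expR_ge1Dx _).
rewrite big_bool /=.
have e1 := ler_wpM2l p0 (expb true).
have p1' : 0 <= 1 - p by lra.
have e0 := ler_wpM2l p1' (expb false).
apply: le_trans (lerD e1 e0) _ => /=.
(* The linear terms cancel because the reward is centred; the quadratic ones sum to 2 a^2 times the
   variance p (1 - p) <= 1/4. *)
rewrite -subr_ge0 (_ : _ - _ = a ^+ 2 * (1 - 2 * (p * (1 - p)))); last by ring.
by rewrite mulr_ge0 ?sqr_ge0//; nra.
Qed.

Definition rewards (k : 'I_K) h : seq bool := [seq x.2 | x <- h & x.1 == k].

Lemma size_rewards k h : size (rewards k h) = count (fun x => x.1 == k) h.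
Proof. by rewrite size_map size_filter. Qed.

Lemma big_rewards_rcons (n : nat) (k : 'I_K) h a b (F : bool -> R) :
  \prod_(c <- take n (rewards k (rcons h (a, b)))) F c =
  \prod_(c <- take n (rewards k h)) F c *
    (if (a == k) && (size (rewards k h) < n)%N then F b else 1).
Proof.
rewrite /rewards filter_rcons /=; case: (a == k) => /=; last by rewrite mulr1.
rewrite map_rcons /=; set r := map _ _; case: ltnP => [rn|nr].
  by rewrite !take_oversize ?size_rcons// 1?ltnW// -cats1 big_cat big_seq1.
by rewrite mulr1 -cats1 takel_cat.
Qed.

(* Keeping the first [n] rewards only makes the sample size deterministic on
   explored histories, although the number of pulls depends on the rewards. *)
Definition dev (n : nat) (k : 'I_K) h m : R :=
  \sum_(b <- take n (rewards k h)) (b%:R - m k).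

(** The compensator [a ^+ 2] is paid per observed reward, so that for small [a] each new reward
    multiplies the product by a factor of mean at most 1 ([bern_mgf]). *)
Definition tilt (n : nat) (a : R) (k : 'I_K) h m : R :=
  \prod_(b <- take n (rewards k h)) expR (a * (b%:R - m k) - a ^+ 2).

Lemma tilt_ge0 n a k h m : 0 <= tilt n a k h m.
Proof. by apply: prodr_ge0 => b _; exact: expR_ge0. Qed.

Lemma dev_full n k h m : (n <= size (rewards k h))%N ->
  dev n k h m = (\sum_(b <- take n (rewards k h)) b%:R) - n%:R * m k.
Proof.
move=> nr; rewrite /dev sumrB; congr (_ - _).
by rewrite big_const_seq count_predT size_takel// iter_addr_0 mulr_natl.
Qed.

Lemma tilt_full n a k h m : (n <= size (rewards k h))%N ->
  tilt n a k h m = expR (a * dev n k h m - n%:R * a ^+ 2).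
Proof.
move=> nr; rewrite /tilt -expR_sum; congr expR.
rewrite sumrB -mulr_sumr; congr (_ - _).
by rewrite big_const_seq count_predT size_takel// iter_addr_0 mulr_natl.
Qed.

(** Since [i != j], a pull changes at most one of the two tilts; pulls of other arms, or beyond the
    first [n], change neither. *)
Lemma tilt_step (n : nat) (a : R) (i j : 'I_K) h m (k : 'I_K) :
  i != j -> `|a| <= 2^-1 -> (forall l, 0 <= m l <= 1) ->
  \sum_(b : bool) bern (m k) b *
    (tilt n a i (rcons h (k, b)) m * tilt n (- a) j (rcons h (k, b)) m) <=
  tilt n a i h m * tilt n (- a) j h m.
Proof.
move=> ij a_le m01.
pose g (c : R) (l : 'I_K) (b : bool) : R := if (k == l) && (size (rewards l h) < n)%N
  then expR (c * (b%:R - m l) - c ^+ 2) else 1.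
have tilt_rcons c l b : tilt n c l (rcons h (k, b)) m = tilt n c l h m * g c l b.
  exact: big_rewards_rcons.
rewrite (eq_bigr (fun b => tilt n a i h m * tilt n (- a) j h m *
    (bern (m k) b * (g a i b * g (- a) j b)))); last first.
  by move=> b _; rewrite !tilt_rcons; ring.
rewrite -mulr_sumr -[X in _ <= X]mulr1 ler_wpM2l ?mulr_ge0 ?tilt_ge0//.
have sum1 l : \sum_(b : bool) bern (m l) b * (1 * 1) <= 1.
  by rewrite big_bool /= !mulr1; lra.
rewrite /g; have [->|ki] := eqVneq k i; last have [->|kj] := eqVneq k j.
- rewrite (negbTE ij) /=; case: ltnP => _; last exact: sum1.
  by under eq_bigr do rewrite mulr1; exact: bern_mgf.
- rewrite /=; case: ltnP => _; last exact: sum1.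
  by under eq_bigr do rewrite mul1r; apply: bern_mgf; rewrite ?normrN.
- exact: sum1.
Qed.

End Histories.

(** * Expectations over means and histories *)

Section BanditExpectation.
Context (R : realType) (d : measure_display) (T : measurableType d)
  (P : probability T R) (K : nat) (mu : 'I_K -> T -> R).
Hypotheses (mmu : forall i, measurable_fun setT (mu i))
  (mu01 : forall i w, 0 <= mu i w <= 1).
Implicit Types (h : seq ('I_K * bool)) (pi : policy R K) (f : T -> R)
  (F G : seq ('I_K * bool) -> T -> R).

Local Notation "E[ f ]" := (Rintegral P setT f).

(* Expectation over the joint law of the state of the world and the history of
   length [t] when [pi] is run. *)
Definition bexpect pi (t : nat) F : R :=
  \sum_(h : t.-tuple ('I_K * bool)) wt pi h * E[ fun w => F h w * lik h (mu^~ w) ].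

Lemma bdmeas_bern (i : 'I_K) (b : bool) : bdmeas (fun w => bern (mu i w) b).
Proof.
case: b => /=; first exact: bdmeas_mean.
by apply: bdmeasB; [exact: bdmeas_cst|exact: bdmeas_mean].
Qed.

Lemma bdmeas_lik h : bdmeas (fun w => lik h (mu^~ w)).
Proof. by apply: bdmeas_prod => x; exact: bdmeas_bern. Qed.

Lemma bdmeas_dev (n : nat) (k : 'I_K) h : bdmeas (fun w => dev n k h (mu^~ w)).
Proof.
by apply: bdmeas_sum => b; apply: bdmeasB; [exact: bdmeas_cst|exact: bdmeas_mean].
Qed.

Lemma bdmeas_tilt (n : nat) (a : R) (k : 'I_K) h :
  bdmeas (fun w => tilt n a k h (mu^~ w)).
Proof.
apply: bdmeas_prod => b; apply: bdmeas_expR; apply: bdmeasB; last exact: bdmeas_cst.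
apply: bdmeasM; first exact: bdmeas_cst.
by apply: bdmeasB; [exact: bdmeas_cst|exact: bdmeas_mean].
Qed.

(** The integrand lies between -M and M times the likelihood. This disposes of null histories, where
    the posterior is a division by 0. *)
Lemma expect_lik_null h f :
  E[ fun w => lik h (mu^~ w) ] = 0 -> bdmeas f ->
  E[ fun w => f w * lik h (mu^~ w) ] = 0.
Proof.
move=> L0 bf; have [_ [M fM]] := bf.
have bL := bdmeas_lik h.
have L_ge0 w : 0 <= lik h (mu^~ w) by apply: lik_ge0.
have bc c : bdmeas (fun w => c * lik h (mu^~ w)) by apply: bdmeasM => //; exact: bdmeas_cst.
have bfL : bdmeas (fun w => f w * lik h (mu^~ w)) by exact: bdmeasM.
have up : E[ fun w => f w * lik h (mu^~ w) ] <= M * E[ fun w => lik h (mu^~ w) ].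
  rewrite -expectZ//; apply: expect_le => // w; apply: ler_wpM2r => //.
  by have := fM w; rewrite ler_norml => /andP[].
have lo : - M * E[ fun w => lik h (mu^~ w) ] <= E[ fun w => f w * lik h (mu^~ w) ].
  rewrite -expectZ//; apply: expect_le => // w; apply: ler_wpM2r => //.
  by have := fM w; rewrite ler_norml => /andP[].
by move: up lo; rewrite L0 !mulr0 => up lo; apply/eqP; rewrite eq_le up.
Qed.

(** Tower rule: condition on the first t rounds, then average over the last arm and its reward. *)
Lemma bexpect_step pi t F : (forall h, bdmeas (F h)) ->
  bexpect pi t.+1 F =
  \sum_(h : t.-tuple ('I_K * bool)) wt pi h * \sum_(a < K) pi h a *
    E[ fun w => (\sum_(b : bool) bern (mu a w) b * F (rcons h (a, b)) w) *
                lik h (mu^~ w) ].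
Proof.
move=> bF; rewrite /bexpect.
rewrite (@sum_tuple_rcons _ _ t (fun h => wt pi h * E[ fun w => F h w * lik h (mu^~ w) ])).
apply: eq_bigr => h _; rewrite (eq_bigr (fun x => wt pi (rcons h (x.1, x.2)) *
  E[ fun w => F (rcons h (x.1, x.2)) w * lik (rcons h (x.1, x.2)) (mu^~ w) ])) => [|[]//].
rewrite -(pair_bigA _ (fun a b => wt pi (rcons h (a, b)) *
  E[ fun w => F (rcons h (a, b)) w * lik (rcons h (a, b)) (mu^~ w) ])) /=.
rewrite mulr_sumr; apply: eq_bigr => a _.
rewrite (_ : (fun w => (\sum_(b : bool) _) * _) = (fun w => \sum_(b : bool)
    F (rcons h (a, b)) w * lik (rcons h (a, b)) (mu^~ w))); last first.
  apply/funext => w; rewrite mulr_suml; apply: eq_bigr => b _.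
  by rewrite lik_rcons /=; ring.
rewrite expect_sum => [|b]; last by apply: bdmeasM => //; exact: bdmeas_lik.
by rewrite mulrA mulr_sumr; apply: eq_bigr => b _; rewrite wt_rcons.
Qed.

Lemma bexpect0 pi F : bexpect pi 0 F = E[ F [::] ].
Proof.
rewrite /bexpect (big_pred1 [tuple]) => [|h]; last by apply/esym/eqP; exact: tuple0.
rewrite /wt /= big_ord0 mul1r; congr Rintegral; apply/funext => w.
by rewrite /lik big_nil mulr1.
Qed.

(** Mass below 1 is allowed because [ts_policy] vanishes on null histories; as [F] is nonnegative,
    lost mass only lowers the expectation. *)
Lemma bexpect_supermartingale pi t F :
  (forall h i, 0 <= pi h i) -> (forall h, \sum_i pi h i <= 1) ->
  (forall h, bdmeas (F h)) -> (forall h w, 0 <= F h w) ->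
  (forall h a w, \sum_(b : bool) bern (mu a w) b * F (rcons h (a, b)) w <= F h w) ->
  bexpect pi t F <= E[ F [::] ].
Proof.
move=> pi_ge0 pi_le1 bF F_ge0 F_step; elim: t => [|t IH]; first by rewrite bexpect0.
apply: le_trans IH; rewrite bexpect_step//; apply: ler_sum => h _.
apply: ler_wpM2l; first exact: wt_ge0.
have bFL : bdmeas (fun w => F h w * lik h (mu^~ w)).
  by apply: bdmeasM => //; exact: bdmeas_lik.
have FL_ge0 : 0 <= E[ fun w => F h w * lik h (mu^~ w) ].
  by apply: Rintegral_ge0 => w _; rewrite mulr_ge0// lik_ge0.
rewrite -[X in _ <= X]mul1r; apply: le_trans (ler_wpM2r FL_ge0 (pi_le1 h)).
rewrite mulr_suml; apply: ler_sum => a _; apply: ler_wpM2l => //.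
apply: expect_le => // [|w].
  apply: bdmeasM; last exact: bdmeas_lik.
  by apply: bdmeas_sum => b; apply: bdmeasM => //; exact: bdmeas_bern.
by apply: ler_wpM2r; [exact: lik_ge0|exact: F_step].
Qed.

(** The two values of [bern] sum to 1, so a round preserves the expectation; histories on which the
    policy may lose mass are null and contribute 0. *)
Lemma bexpect_static pi t f :
  (forall h, E[ fun w => lik h (mu^~ w) ] != 0 -> \sum_i pi h i = 1) ->
  bdmeas f -> bexpect pi t (fun=> f) = E[ f ].
Proof.
move=> pi1 bf; elim: t => [|t <-]; first by rewrite bexpect0.
rewrite bexpect_step//; apply: eq_bigr => h _; congr (_ * _).
rewrite (eq_bigr (fun a => pi h a * E[ fun w => f w * lik h (mu^~ w) ])).
  rewrite -mulr_suml; have [L0|L0] := eqVneq E[ fun w => lik h (mu^~ w) ] 0.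
    by rewrite expect_lik_null// mulr0.
  by rewrite pi1// mul1r.
move=> a _; congr (_ * _); congr Rintegral; apply/funext => w.
by rewrite big_bool /=; ring.
Qed.

(* Conditioning on an event [Y] of small probability [p] inflates the
   deviations by [log (1/p)] only: [1 + x <= expR x] bounds [a * z] on [Y] by
   [p * expR (a * z - 2 n a^2) + c - 1] with [c = 2 n a^2 + ln (1 / p)]. *)
Lemma bexpect_dev_le pi t (n : nat) (i j : 'I_K) (a p : R)
    (Y : seq ('I_K * bool) -> T -> R) :
  (forall h i, 0 <= pi h i) -> (forall h, \sum_i pi h i <= 1) ->
  i != j -> 0 < a <= 2^-1 -> 0 < p ->
  (forall h, bdmeas (Y h)) -> (forall h w, 0 <= Y h w <= 1) ->
  bexpect pi t Y = p ->
  (forall h : t.-tuple ('I_K * bool),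
     wt pi h != 0 -> E[ fun w => lik h (mu^~ w) ] != 0 ->
     (n <= size (rewards i h))%N /\ (n <= size (rewards j h))%N) ->
  a * bexpect pi t (fun h w => Y h w * (dev n i h (mu^~ w) - dev n j h (mu^~ w)))
    <= p * (2 * n%:R * a ^+ 2 - ln p).
Proof.
move=> pi_ge0 pi_le1 ij /andP[a_gt0 a_le] p_gt0 bY Y01 YP full.
pose V h w := tilt n a i h (mu^~ w) * tilt n (- a) j h (mu^~ w).
have bV h : bdmeas (V h) by apply: bdmeasM; exact: bdmeas_tilt.
have V_ge0 h w : 0 <= V h w by rewrite mulr_ge0 ?tilt_ge0.
have V_le1 : bexpect pi t V <= 1.
  rewrite -[X in _ <= X](expect_cst P).
  rewrite (_ : (fun=> 1) = V [::]); last first.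
    by apply/funext => w; rewrite /V /tilt /= !big_nil mulr1.
  apply: bexpect_supermartingale => // h k w.
  by apply: tilt_step => //; rewrite ger0_norm// ltW.
pose c := 2 * n%:R * a ^+ 2 - ln p.
(* As E[V] <= 1 and E[Y] = p, the new bound is at most p + (c - 1) p = p c. *)
suff : a * bexpect pi t (fun h w => Y h w * (dev n i h (mu^~ w) - dev n j h (mu^~ w)))
    <= p * bexpect pi t V + (c - 1) * bexpect pi t Y.
  move=> /le_trans; apply; rewrite YP -/c.
  by have := ler_wpM2l (ltW p_gt0) V_le1; lra.
rewrite /bexpect !mulr_sumr -big_split /=; apply: ler_sum => h _.
have [w0|w0] := eqVneq (wt pi h) 0; first by rewrite w0 !mul0r !mulr0 addr0.
have bL := bdmeas_lik h.
have bZ : bdmeas (fun w => Y h w * (dev n i h (mu^~ w) - dev n j h (mu^~ w))).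
  by apply: bdmeasM => //; apply: bdmeasB; exact: bdmeas_dev.
have [L0|L0] := eqVneq E[ fun w => lik h (mu^~ w) ] 0.
  rewrite (expect_lik_null L0 bZ) (expect_lik_null L0 (bV h)).
  by rewrite (expect_lik_null L0 (bY h)) !mulr0 addr0.
have [full_i full_j] := full h w0 L0.
rewrite !(mulrCA _ (wt pi h)) -mulrDr; apply: ler_wpM2l; first exact: wt_ge0.
have bVL : bdmeas (fun w => V h w * lik h (mu^~ w)) by exact: bdmeasM.
have bYL : bdmeas (fun w => Y h w * lik h (mu^~ w)) by exact: bdmeasM.
have bZL := bdmeasM bZ bL.
have bc r f : bdmeas f -> bdmeas (fun w => r * f w).
  by move=> bf; apply: bdmeasM => //; exact: bdmeas_cst.
rewrite -!expectZ// -expectD; try exact: bc.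
apply: expect_le => [||w]; [exact: bc|by apply: bdmeasD; exact: bc|].
rewrite !mulrA -mulrDl; apply: ler_wpM2r; first exact: lik_ge0.
rewrite /V !tilt_full// -(mulrA p) -expRD.
set z := dev n i h _ - dev n j h _.
have pV : 1 + (a * z - c) <= p * expR (a * dev n i h (mu^~ w) - n%:R * a ^+ 2
    + (- a * dev n j h (mu^~ w) - n%:R * (- a) ^+ 2)).
  rewrite -{1}[p]lnK ?posrE// -expRD.
  rewrite [X in expR X](_ : _ = a * z - c); first exact: expR_ge1Dx.
  by rewrite /z /c; ring.
set W := p * expR _ in pV *.
have W_ge0 : 0 <= W by rewrite mulr_ge0 ?expR_ge0 ?ltW.
(* Multiplying by [Y] weights the linear side, and [Y <= 1] then removes the weight from the
   exponential. *)
have /andP[y0 y1] := Y01 h w.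
have := ler_wpM2l y0 pV; have := ler_wpM2r W_ge0 y1; rewrite mul1r.
by rewrite -/z; nra.
Qed.

End BanditExpectation.

(** * Uniqueness of the best arm and the posterior policy *)

Lemma sum_is_best (R : realType) (K : nat) (m : 'I_K -> R) : (0 < K)%N ->
  \sum_(i < K) (is_best m i)%:R = 1 :> R.
Proof.
case: K m => // K m _.
have [i1 max1] : exists i1, forall k, m k <= m i1.
  have [i1 _ max1] := @Order.TotalTheory.arg_maxP _ _ _ ord0 xpredT m isT.
  by exists i1 => k; exact: max1.
(* Among the maximisers, the best arm is the one of least index. *)
have [i0 /eqP m0 min0] := @arg_minnP _ i1 (fun i => m i == m i1) (fun i => i : nat) (eqxx _).
have best0 : is_best m i0.
  rewrite is_best_beats; apply/forallP => k; rewrite /beats m0.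
  case: ltnP => // k_lt; rewrite lt_neqAle max1 andbT.
  by apply/negP => /min0; rewrite leqNgt k_lt.
rewrite (bigD1 i0)//= best0 big1 ?addr0// => k ki0.
case: (boolP (is_best m k)) => // best_k; exfalso.
have /forallP beat_k : [forall l, beats m k l] by rewrite -is_best_beats.
have /forallP beat_0 : [forall l, beats m i0 l] by rewrite -is_best_beats.
(* Of two best arms, the one of larger index would win strictly and the other weakly. *)
have := beat_k i0; have := beat_0 k; rewrite /beats.
case: ltngtP => [||/val_inj ki]; last by rewrite ki eqxx in ki0.
- by move=> _ lt1 le1; move: (lt_le_trans lt1 le1); rewrite ltxx.
- by move=> _ le1 lt1; move: (le_lt_trans le1 lt1); rewrite ltxx.
Qed.

Section ThompsonSampling.
Context (R : realType) (d : measure_display) (T : measurableType d)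
  (P : probability T R) (K : nat) (mu : 'I_K -> T -> R).
Hypotheses (mmu : forall i, measurable_fun setT (mu i))
  (mu01 : forall i w, 0 <= mu i w <= 1) (K_gt0 : (0 < K)%N).
Implicit Types (h : seq ('I_K * bool)) (alg : policy R K).

Local Notation "E[ f ]" := (Rintegral P setT f).
Local Notation best i := (fun w => (is_best (mu^~ w) i)%:R : R).

Lemma sum_expect_best : \sum_(i < K) E[ best i ] = 1.
Proof.
rewrite -expect_sum => [|i]; last exact: bdmeas_is_best.
rewrite -[RHS](expect_cst P); congr Rintegral; apply/funext => w.
exact: sum_is_best.
Qed.

Lemma ts_policy_ge0 h i : 0 <= ts_policy P mu h i.
Proof.
by apply: divr_ge0; apply: Rintegral_ge0 => w _; rewrite ?mulr_ge0 ?ler0n ?lik_ge0.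
Qed.

Lemma sum_ts_policy h : E[ fun w => lik h (mu^~ w) ] != 0 ->
  \sum_(i < K) ts_policy P mu h i = 1.
Proof.
move=> L0; rewrite -mulr_suml -[RHS](divff L0); congr (_ / _).
rewrite -expect_sum => [|i]; last first.
  by apply: bdmeasM; [exact: bdmeas_is_best|exact: bdmeas_lik].
by congr Rintegral; apply/funext => w; rewrite -mulr_suml sum_is_best// mul1r.
Qed.

(* On null histories [ts_policy] is the zero vector, since x / 0 = 0. *)
Lemma sum_ts_policy_le1 h : \sum_(i < K) ts_policy P mu h i <= 1.
Proof.
have [L0|/sum_ts_policy->//] := eqVneq E[ fun w => lik h (mu^~ w) ] 0.
by rewrite big1 ?ler01// => i _; rewrite /ts_policy /Emu L0 invr0 mulr0.
Qed.

(** Bayes' rule without division; on null histories both sides vanish. *)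
Lemma ts_policy_lik h i :
  ts_policy P mu h i * E[ fun w => lik h (mu^~ w) ] =
  E[ fun w => (is_best (mu^~ w) i)%:R * lik h (mu^~ w) ].
Proof.
have [L0|L0] := eqVneq E[ fun w => lik h (mu^~ w) ] 0.
  by rewrite L0 mulr0 expect_lik_null//; exact: bdmeas_is_best.
by rewrite /ts_policy /Emu divfK.
Qed.

Lemma ts_policy_le1 h i : ts_policy P mu h i <= 1.
Proof.
apply: le_trans (sum_ts_policy_le1 h); rewrite (bigD1 i)//= lerDl.
by apply: sumr_ge0 => k _; exact: ts_policy_ge0.
Qed.

(** A weight consults the policy on proper prefixes only, hence length [T0] is included. *)
Lemma wt_then_ts_early alg T0 h : (size h <= T0)%N ->
  wt (then_ts P mu alg T0) h = wt alg h.
Proof.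
move=> hT0; apply: eq_bigr => s _.
by rewrite /then_ts size_takel ?(ltnW (ltn_ord s))// (leq_trans (ltn_ord s)).
Qed.

Lemma wt_cat (pi : policy R K) h h' :
  exists c, wt pi (h ++ h') = wt pi h * c.
Proof.
elim/last_ind: h' => [|h' x [c IH]]; first by exists 1; rewrite cats0 mulr1.
by exists (c * pi (h ++ h') x.1); rewrite -rcons_cat wt_rcons IH mulrA.
Qed.

Lemma expect_lik_cat h h' :
  E[ fun w => lik (h ++ h') (mu^~ w) ] <= E[ fun w => lik h (mu^~ w) ].
Proof.
apply: expect_le => [||w]; [exact: bdmeas_lik..|].
rewrite (_ : lik (h ++ h') _ = lik h (mu^~ w) * lik h' (mu^~ w)); last exact: big_cat.
by apply: ler_piMr; [exact: lik_ge0|exact: lik_le1].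
Qed.

(** * Thompson rounds after exploration *)

Section AfterExploration.
Variables (alg : policy R K) (T0 : nat) (n : nat).
Hypotheses (alg_valid : valid_policy alg)
  (explored : forall h : T0.-tuple ('I_K * bool),
     0 < wt alg h * E[ fun w => lik h (mu^~ w) ] -> forall i : 'I_K, (n <= count (fun x => x.1 == i) h)%N).

Local Notation pi := (then_ts P mu alg T0).

Lemma then_ts_ge0 h i : 0 <= pi h i.
Proof.
by rewrite /then_ts; case: ifP => _; [case: (alg_valid h)|exact: ts_policy_ge0].
Qed.

Lemma sum_then_ts h : E[ fun w => lik h (mu^~ w) ] != 0 -> \sum_i pi h i = 1.
Proof.
by rewrite /then_ts; case: ifP => _; [case: (alg_valid h)|exact: sum_ts_policy].
Qed.

Lemma sum_then_ts_le1 h : \sum_i pi h i <= 1.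
Proof.
rewrite /then_ts; case: ifP => _; last exact: sum_ts_policy_le1.
by case: (alg_valid h) => _ ->.
Qed.

(** The prefix of length [T0] has positive probability under [alg], so it is explored; later pulls
    only add samples. *)
Lemma then_ts_explored t (h : t.-tuple ('I_K * bool)) (i : 'I_K) : (T0 <= t)%N ->
  wt pi h != 0 -> E[ fun w => lik h (mu^~ w) ] != 0 -> (n <= size (rewards i h))%N.
Proof.
move=> T0t w0 L0.
have size_h0 : size (take T0 h) = T0 by rewrite size_takel// size_tuple.
have h0P : size (take T0 h) == T0 by rewrite size_h0.
have [c wtE] := wt_cat pi (take T0 h) (drop T0 h); rewrite cat_take_drop in wtE.
have L_ge0 h' : 0 <= E[ fun w => lik h' (mu^~ w) ].
  by apply: Rintegral_ge0 => w _; exact: lik_ge0.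
have pos : 0 < wt alg (take T0 h) * E[ fun w => lik (take T0 h) (mu^~ w) ].
  apply: mulr_gt0.
    rewrite lt0r -[in X in _ && X](@wt_then_ts_early alg T0) ?size_h0//.
    rewrite wt_ge0 ?andbT; last exact: then_ts_ge0.
    rewrite -(@wt_then_ts_early alg T0) ?size_h0//.
    by apply: contraNneq w0 => wh0; rewrite wtE wh0 mul0r.
  apply: lt_le_trans (expect_lik_cat (take T0 h) (drop T0 h)).
  by rewrite cat_take_drop lt0r L0 L_ge0.
rewrite size_rewards; apply: leq_trans (explored (h := Tuple h0P) pos i) _.
by rewrite -[in X in (_ <= X)%N](cat_take_drop T0 h) count_cat leq_addr.
Qed.

(* The empirical means depend on the history only, on which the indicator of
   [A^* = i] and its posterior probability have the same conditional
   expectation: their contributions to the two error terms cancel. *)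
Lemma gainA_then_ts t (i j : 'I_K) : (T0 <= t)%N ->
  n%:R * gainA P mu pi t i j =
  n%:R * E[ fun w => (mu i w - mu j w) * (is_best (mu^~ w) i)%:R ]
  - bexpect P mu pi t (fun h w => (is_best (mu^~ w) i)%:R *
        (dev n j h (mu^~ w) - dev n i h (mu^~ w)))
  - bexpect P mu pi t (fun h w => ts_policy P mu h i *
        (dev n i h (mu^~ w) - dev n j h (mu^~ w))).
Proof.
move=> T0t.
have bD : bdmeas (fun w => mu i w - mu j w) by apply: bdmeasB; exact: bdmeas_mean.
have bB : bdmeas (best i) by exact: bdmeas_is_best.
have bDB : bdmeas (fun w => (mu i w - mu j w) * (is_best (mu^~ w) i)%:R).
  exact: bdmeasM.
rewrite -(bexpect_static (P := P) mmu mu01 t sum_then_ts bDB).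
rewrite /gainA /bexpect !mulr_sumr -!sumrB; apply: eq_bigr => h _.
have [w0|w0] := eqVneq (wt pi h) 0; first by rewrite w0 !mul0r !mulr0 !subr0.
have bdev k : bdmeas (fun w => dev n k h (mu^~ w)) by exact: bdmeas_dev.
have bZ k l : bdmeas (fun w => dev n k h (mu^~ w) - dev n l h (mu^~ w)).
  exact: bdmeasB.
have bBZ k l : bdmeas (fun w => (is_best (mu^~ w) i)%:R *
    (dev n k h (mu^~ w) - dev n l h (mu^~ w))).
  exact: bdmeasM.
have bc r f : bdmeas f -> bdmeas (fun w : T => r * f w).
  by move=> bf; apply: bdmeasM => //; exact: bdmeas_cst.
have bL := bdmeas_lik mmu mu01 h.
have ts_out f : bdmeas f -> E[ fun w => ts_policy P mu h i * f w * lik h (mu^~ w) ] =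
    ts_policy P mu h i * E[ fun w => f w * lik h (mu^~ w) ].
  move=> bf; rewrite -expectZ; last exact: bdmeasM.
  by congr Rintegral; apply/funext => w; rewrite mulrA.
rewrite ts_out//.
have -> : pi h i = ts_policy P mu h i by rewrite /then_ts size_tuple ltnNge T0t.
rewrite /Emu; have [L0|L0] := eqVneq E[ fun w => lik h (mu^~ w) ] 0.
  by rewrite (expect_lik_null mmu mu01 L0 bD) (expect_lik_null mmu mu01 L0 bDB)
    (expect_lik_null mmu mu01 L0 (bBZ _ _)) (expect_lik_null mmu mu01 L0 (bZ _ _))
    !mulr0 !subr0.
(* The part of [dev] known from the history, which leaves the expectation as a constant. *)
pose S k : R := \sum_(b <- take n (rewards k h)) b%:R.
have devE k w : dev n k h (mu^~ w) = S k - n%:R * mu k w.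
  by apply: dev_full; exact: then_ts_explored.
have E1 : E[ fun w => (dev n i h (mu^~ w) - dev n j h (mu^~ w)) * lik h (mu^~ w) ] =
    (S i - S j) * E[ fun w => lik h (mu^~ w) ] -
    n%:R * E[ fun w => (mu i w - mu j w) * lik h (mu^~ w) ].
  have bDL := bdmeasM bD bL.
  rewrite -!expectZ -?expectB//; try exact: bc.
  by congr Rintegral; apply/funext => w; rewrite !devE; ring.
have E2 : E[ fun w => (is_best (mu^~ w) i)%:R *
      (dev n j h (mu^~ w) - dev n i h (mu^~ w)) * lik h (mu^~ w) ] =
    n%:R * E[ fun w => (mu i w - mu j w) * (is_best (mu^~ w) i)%:R * lik h (mu^~ w) ]
    - (S i - S j) * E[ fun w => (is_best (mu^~ w) i)%:R * lik h (mu^~ w) ].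
  have bDBL := bdmeasM bDB bL; have bBL := bdmeasM bB bL.
  rewrite -!expectZ -?expectB//; try exact: bc.
  by congr Rintegral; apply/funext => w; rewrite !devE; ring.
by rewrite E1 E2 -ts_policy_lik; ring.
Qed.

(** With a = eps / 8, [bexpect_dev_le] bounds each error by p (n eps / 4 + 8 ln(1/p) / eps), hence
    by n p eps / 2; together they do not exceed the main term n p eps. *)
Lemma gainA_then_ts_ge0 t (i j : 'I_K) (eps : R) : (T0 <= t)%N -> i != j ->
  indep_means P mu -> (0 < n)%N -> 0 < eps <= 1 -> 0 < E[ best i ] ->
  eps <= E[ fun w => Num.max (mu i w - mu j w) 0 ] ->
  - 32 * ln E[ best i ] <= n%:R * eps ^+ 2 ->
  0 <= gainA P mu pi t i j.
Proof.
move=> T0t ij indep n_gt0 /andP[e_gt0 e_le1] p_gt0 e_gap n_ge.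
set p := E[ best i ] in p_gt0 n_ge *.
have best01 w : 0 <= ((is_best (mu^~ w) i)%:R : R) <= 1.
  by case: is_best; rewrite /= ?lexx ?ler01.
have n_gt0' : 0 < n%:R :> R by rewrite ltr0n.
rewrite -(pmulr_rge0 _ n_gt0') gainA_then_ts//.
have gap := expect_gap_best mmu mu01 indep ij; rewrite -/p in gap.
have gap' : eps * p <= E[ fun w => (mu i w - mu j w) * (is_best (mu^~ w) i)%:R ].
  by apply: le_trans gap; rewrite ler_wpM2r// ltW.
have e8 : 0 < eps / 8 <= 2^-1 by apply/andP; split; lra.
have bB : bdmeas (best i) by exact: bdmeas_is_best.
have full k l (h : t.-tuple ('I_K * bool)) :
    wt pi h != 0 -> E[ fun w => lik h (mu^~ w) ] != 0 ->
    (n <= size (rewards k h))%N /\ (n <= size (rewards l h))%N.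
  by move=> w0 L0; split; exact: then_ts_explored.
(* The posterior weight also has mean p, so both errors obey the same bound. *)
have ts_mean : bexpect P mu pi t (fun h w => ts_policy P mu h i) = p.
  rewrite /p -(bexpect_static (P := P) mmu mu01 t sum_then_ts bB).
  apply: eq_bigr => h _; congr (_ * _); rewrite -ts_policy_lik.
  by rewrite -expectZ//; exact: bdmeas_lik.
(* The error weighted by the indicator has the opposite sign, so the arms are exchanged. *)
have := @bexpect_dev_le _ _ _ P _ mu mmu mu01 pi t n j i (eps / 8) p
  (fun h => best i) then_ts_ge0 sum_then_ts_le1.
rewrite eq_sym => /(_ ij e8 p_gt0 (fun=> bB)) err1.
have {}err1 := err1 _ (bexpect_static (P := P) mmu mu01 t sum_then_ts bB) (full j i).
have := @bexpect_dev_le _ _ _ P _ mu mmu mu01 pi t n i j (eps / 8) p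
  (fun h w => ts_policy P mu h i) then_ts_ge0 sum_then_ts_le1 ij e8 p_gt0
  (fun h => bdmeas_cst _ _) _ ts_mean (full i j).
have ts01 h : 0 <= ts_policy P mu h i <= 1 by rewrite ts_policy_ge0 ts_policy_le1.
move=> err2; have {}err2 := err2 (fun h w => ts01 h).
have {}err1 := err1 (fun h w => best01 w).
set X1 := bexpect _ _ _ _ _ in err1 *; set X2 := bexpect _ _ _ _ _ in err2 *.
set G := E[ _ ] in gap' *.
have nG := ler_wpM2l (ltW n_gt0') gap'.
rewrite -(pmulr_rge0 _ e_gt0).
have npe := ler_wpM2l (ltW p_gt0) n_ge.
have enG := ler_wpM2l (ltW e_gt0) nG.
lra.
Qed.

End AfterExploration.
End ThompsonSampling.

(** * Choice of the sample size, and rounds before and after [T0] *)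

Theorem theorem3p1 (R : realType) :
  exists C : R, 0 < C /\
  forall (d : measure_display) (T : measurableType d) (P : probability T R)
    (K : nat) (mu : 'I_K -> T -> R) (alg : policy R K) (T0 : nat),
    (1 < K)%N ->
    (forall i, measurable_fun setT (mu i)) ->
    (forall i w, 0 <= mu i w <= 1) ->
    indep_means P mu ->
    valid_policy alg ->
    BIC P mu alg ->
    0 < epsTS P mu -> 0 < deltaTS P mu ->
    (forall h : T0.-tuple ('I_K * bool), 0 < wt alg h * Emu P mu (lik h) ->
       forall i : 'I_K,
         C * (epsTS P mu) ^- 2 * ln ((deltaTS P mu)^-1)
           <= (count (fun x => x.1 == i) h)%:R) ->
    BIC P mu (then_ts P mu alg T0).
Proof.
(* 32 = 8 * 4: for the tilt eps / 8, the term 8 ln(1/p) / eps must be at most n eps / 4. *)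
exists 32; split; first by rewrite ltr0n.
move=> d T P K mu alg T0 K_gt1 mmu mu01 indep alg_valid alg_bic.
set eps := epsTS P mu; set delta := deltaTS P mu => eps_gt0 delta_gt0 explored.
have K_gt0 : (0 < K)%N by exact: ltnW.
(* Before [T0] the two policies agree, so the property is inherited from [alg]. *)
move=> t i j prob_gt0; have [t_lt|T0t] := ltnP t T0.
  have eq_term (h : t.-tuple ('I_K * bool)) :
      wt (then_ts P mu alg T0) h = wt alg h /\ then_ts P mu alg T0 h i = alg h i.
    by rewrite wt_then_ts_early /then_ts size_tuple ?t_lt// ltnW.
  have probE : probA P mu (then_ts P mu alg T0) t i = probA P mu alg t i.
    by apply: eq_bigr => h _; have [-> ->] := eq_term h.
  have -> : gainA P mu (then_ts P mu alg T0) t i j = gainA P mu alg t i j.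
    by apply: eq_bigr => h _; have [-> ->] := eq_term h.
  by rewrite probE in prob_gt0 *; exact: alg_bic.
apply: divr_ge0; last exact: ltW.
(* [epsTS] ranges over distinct arms only; for equal arms the gain is 0. *)
have [->|ij] := eqVneq i j.
  rewrite /gainA big1 // => h _; rewrite /Emu.
  under eq_fun do rewrite subrr mul0r.
  by rewrite (expect_cst P) mulr0.
pose p k := Rintegral P setT (fun w => (is_best (mu^~ w) k)%:R).
have delta_le k : delta <= p k by exact: bigmin_le_cond.
have p_gt0 k : 0 < p k by exact: lt_le_trans (delta_le k).
(* Two arms of positive probability share mass at most 1. Hence N, and with it n, is positive. *)
have delta_lt1 : delta < 1.
  have p_le : p i + p j <= 1.
    rewrite -(sum_expect_best P mmu K_gt0) (bigD1 i)//= (bigD1 j) 1?eq_sym//=.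
    rewrite lerD2l lerDl; apply: sumr_ge0 => k _.
    exact: ltW (p_gt0 k).
  by have := delta_le i; have := p_gt0 j; lra.
pose N := 32 * eps ^- 2 * ln delta^-1.
have N_gt0 : 0 < N.
  by rewrite !mulr_gt0 ?invr_gt0 ?exprn_gt0// lnV ?posrE// oppr_gt0 ln_lt0 ?delta_gt0.
(* The least natural number n >= N: counts that are at least N are then at least n. *)
have exN : exists n : nat, N <= n%:R.
  by exists (Num.truncn N).+1; exact/ltW/truncnS_gt.
have [n N_le n_min] := ex_minnP exN.
apply: (@gainA_then_ts_ge0 _ _ _ P _ _ mmu mu01 K_gt0 alg T0 n alg_valid _ t i j eps) => //.
- by move=> h h_pos k; apply: n_min; exact: explored.
- by rewrite -(ltr0n R) (lt_le_trans N_gt0).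
(* [eps <= 1] comes from the default value 1 of the minimum. *)
- by rewrite eps_gt0 /eps /epsTS bigmin_le_id.
- exact: p_gt0.
- exact: (@bigmin_le_cond _ _ _ _ (i, j)).
have e2 : 0 < eps ^+ 2 by rewrite exprn_gt0.
rewrite -ler_pdivrMr//; apply: le_trans N_le.
have ln_le : ln delta <= ln (p i) by rewrite ler_ln ?posrE.
rewrite /N lnV ?posrE// [leRHS]mulrAC ler_pM2r ?invr_gt0//.
by rewrite -/(p i); lra.
Qed.
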